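(* Let $R$ be an ordered ring that is not a division ring, with set of positives $P$. Suppose $R$ has a smallest positive element, i.e. there is $p\in P$ with $p\le r$ for all $r\in P$. Then there exist positive integers $m,n$ and data $A\in R^{m\times n}$, $\vec b\in R^m$, $\vec c\in R^n$ such that the associated primal program and dual program both attain optimal solutions, but their optimal objective values are different; that is, if $\vec x^*$ is an optimal solution of the primal program and $\vec y^*$ is an optimal solution of the dual program, then $\vec c^{\,T}\vec x^*\neq (\vec y^* )^{T}\vec b$.
   Context: Rings are associative with identity $1$, not necessarily commutative. A ring $R$ is ordered if there is a non-empty subset $P\subset R$ (the positives) such that: (1) $R$ is the disjoint union $P\sqcup\{0\}\sqcup -P$; (2) $a,b\in P$ implies $a+b\in P$; (3) $a,b\in P$ implies $ab\in P$. Write $a>b$ if $a-b\in P$, and $a\ge b$ if $a-b\in P\cup\{0\}$. Inequalities between vectors are entrywise. Given $A\in R^{m\times n}$, $\vec b\in R^m$, $\vec c\in R^n$, the primal program is: find $\vec x\in R^n$ with $A\vec x\le \vec b$ and $\vec x\ge 0$ (such $\vec x$ are called feasible) maximizing $f(\vec x)=\vec c^{\,T}\vec x$. The dual program is: find $\vec y\in R^m$ with $\vec y^{\,T}A\ge \vec c^{\,T}$ and $\vec y\ge 0$ (such $\vec y$ are called feasible) minimizing $g(\vec y)=\vec y^{\,T}\vec b$. An optimal solution is a feasible vector attaining the maximum of $f$ (respectively the minimum of $g$) over all feasible vectors. *)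

(* Defs.v *)
From HB Require Import structures.
From mathcomp Require Import all_boot all_algebra.

Set Implicit Arguments.
Unset Strict Implicit.
Unset Printing Implicit Defensive.

Import GRing.Theory.
Local Open Scope ring_scope.

(* MathComp's numDomainType is commutative, so ordered rings are set up here
   over a possibly noncommutative pzRingType.
   In the first two clauses, a \in -P is written P (- a), and the disjointness
   of {0} and -P is subsumed by ~ P 0, because - 0 = 0. *)
Record positives (R : pzRingType) (P : R -> Prop) : Prop := Positives {
  positives_cover : forall a, [\/ P a, a = 0 | P (- a)];
  positives_disjoint : ~ P 0 /\ (forall a, ~ (P a /\ P (- a)));
  positives_nonempty : exists a, P a;
  positivesD : forall a b, P a -> P b -> P (a + b);
  positivesM : forall a b, P a -> P b -> P (a * b)
}.

Definition ole (R : pzRingType) (P : R -> Prop) (a b : R) : Prop :=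
  P (b - a) \/ b - a = 0.

Definition mxole (R : pzRingType) (P : R -> Prop) (m n : nat)
    (A B : 'M[R]_(m, n)) : Prop :=
  forall i j, ole P (A i j) (B i j).

Definition division_ring (R : pzRingType) : Prop :=
  (1 : R) <> 0 /\ forall a : R, a <> 0 -> exists b, a * b = 1 /\ b * a = 1.

Definition smallest_positive (R : pzRingType) (P : R -> Prop) (p : R) : Prop :=
  P p /\ forall r, P r -> ole P p r.

Section LinearPrograms.

Variables (R : pzRingType) (P : R -> Prop) (m n : nat).
Variables (A : 'M[R]_(m, n)) (b : 'cV[R]_m) (c : 'cV[R]_n).

Definition primal_feasible (x : 'cV[R]_n) : Prop :=
  mxole P (A *m x) b /\ mxole P 0 x.

Definition primal_value (x : 'cV[R]_n) : R := (c^T *m x) ord0 ord0.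

Definition primal_optimal (x : 'cV[R]_n) : Prop :=
  primal_feasible x /\
  forall x', primal_feasible x' -> ole P (primal_value x') (primal_value x).

Definition dual_feasible (y : 'cV[R]_m) : Prop :=
  mxole P c^T (y^T *m A) /\ mxole P 0 y.

Definition dual_value (y : 'cV[R]_m) : R := (y^T *m b) ord0 ord0.

Definition dual_optimal (y : 'cV[R]_m) : Prop :=
  dual_feasible y /\
  forall y', dual_feasible y' -> ole P (dual_value y) (dual_value y').

End LinearPrograms.

(* Main.v *)
(* A smallest positive element p must be 1: otherwise p < 1 and 0 < p * p < p.
   So there is nothing strictly between 0 and 1, and the programs
   "maximize x with 2 x <= 1, x >= 0" and "minimize y with y 2 >= 1, y >= 0"
   have optimal values 0 and 1, the optima of their integer versions. *)
Require Import Defs.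
From mathcomp Require Import all_boot all_algebra.

Set Implicit Arguments.
Unset Strict Implicit.
Unset Printing Implicit Defensive.

Import GRing.Theory.
Local Open Scope ring_scope.

Section OrderedRing.

Variables (R : pzRingType) (P : R -> Prop).
Hypothesis hP : positives P.

Lemma positives_neq0 (a : R) : P a -> a <> 0.
Proof. by have [P0 _] := positives_disjoint hP; move=> Pa a0; rewrite a0 in Pa. Qed.

Lemma positives_asym (a : R) : P a -> ~ P (- a).
Proof. by have [_ dP] := positives_disjoint hP; move=> Pa Na; case: (dP a). Qed.

(** If [1 = 0] the ring is trivial, leaving no room for a positive element; if [- 1] is positive, so
    is its square, which is [1]. *)
Lemma positives1 : P 1.
Proof.
case: (positives_cover hP 1) => // [R0|N1].
  have [a Pa] := positives_nonempty hP.
  by case: (positives_neq0 Pa); rewrite -[a]mulr1 R0 mulr0.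
by have := positivesM hP N1 N1; rewrite mulrNN mulr1.
Qed.

Lemma smallest_positive_eq1 (p : R) : smallest_positive P p -> p = 1.
Proof.
case=> Pp minp; case: (minp 1 positives1) => [lt_p1 | /subr0_eq -> //].
have lt_pp: P (p - p * p).
  by have := positivesM hP Pp lt_p1; rewrite mulrBr mulr1.
case: (minp _ (positivesM hP Pp Pp)) => [|/subr0_eq pp].
  by rewrite -opprB => /(positives_asym lt_pp).
by case: (positives_neq0 lt_pp); rewrite pp subrr.
Qed.

Hypothesis smallest1 : smallest_positive P 1.

(** A positive [x] would be at least [1] by minimality, which forces [x *+ 2] above [1]. *)
Lemma eq0_of_double_le1 (x : R) : ole P 0 x -> ole P (x *+ 2) 1 -> x = 0.
Proof.
case; rewrite subr0 // => /(smallest1.2) le1x le2x1.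
suff Px: P (x *+ 2 - 1).
  case: le2x1 => [|/subr0_eq E]; first by rewrite -opprB => /(positives_asym Px).
  by case: (positives_neq0 Px); rewrite -E subrr.
(* Everything is expressed through [x - 1], which is positive or zero; the trailing [1] keeps the
   sum positive even when [x = 1]. *)
have -> : x *+ 2 - 1 = (x - 1) + ((x - 1) + 1) by rewrite subrK mulr2n addrAC.
case: le1x => [Px1|->]; last by rewrite !add0r; exact: positives1.
by do 2! [apply: (positivesD hP) => //]; exact: positives1.
Qed.

(** Minimality settles a positive [y]; the bound on [y *+ 2] serves to exclude [y = 0]. *)
Lemma ge1_of_double_ge1 (y : R) : ole P 0 y -> ole P 1 (y *+ 2) -> ole P 1 y.
Proof.
rewrite {1}/ole subr0 => -[/(smallest1.2) //|->].
rewrite mul0rn {1}/ole sub0r; case=> [/(positives_asym positives1) //|/eqP].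
by rewrite oppr_eq0 => /eqP /(positives_neq0 positives1).
Qed.

Let A : 'M[R]_1 := const_mx 2%:R.
(** The same vector serves as right-hand side, as objective and as optimal dual solution. *)
Let u : 'cV[R]_1 := const_mx 1.

Lemma double_primal_feasibleP (x : 'cV[R]_1) :
  primal_feasible P A u x <-> x = 0.
Proof.
split=> [[Ax x0]|->].
  apply/matrixP=> i j; rewrite !ord1 mxE.
  apply: eq0_of_double_le1; first by have := x0 0 0; rewrite mxE.
  (* The primal multiplies by [2] on the left, the dual on the right; both products are [*+ 2], so
     noncommutativity does no harm. *)
  by have := Ax 0 0; rewrite !mxE big_ord1 !mxE mulr_natl.
split=> i j; rewrite ?mulmx0 !mxE; last by right; rewrite subrr.
by left; rewrite subr0; exact: positives1.
Qed.

(** This lower bound on the dual value is attained at [u], which makes [u] optimal. *)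
Lemma double_dual_feasible_ge1 (y : 'cV[R]_1) :
  dual_feasible P A u y -> ole P 1 (y 0 0).
Proof.
case=> yA y0; apply: ge1_of_double_ge1; first by have := y0 0 0; rewrite mxE.
by have := yA 0 0; rewrite !mxE big_ord1 !mxE mulr_natr.
Qed.

Lemma double_dual_feasible1 : dual_feasible P A u u.
Proof.
split=> i j; rewrite !ord1 !mxE ?big_ord1 ?mxE; left.
  by rewrite mul1r mulr2n addrK; exact: positives1.
by rewrite subr0; exact: positives1.
Qed.

Lemma double_dual_valueE (y : 'cV[R]_1) : dual_value u y = y 0 0.
Proof. by rewrite /dual_value mxE big_ord1 !mxE mulr1. Qed.

Lemma double_duality_gap :
  [/\ exists x, primal_optimal P A u u x,
      exists y, dual_optimal P A u u y &
      forall x y, primal_optimal P A u u x -> dual_optimal P A u u y ->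
        primal_value u x <> dual_value u y].
Proof.
split.
- exists 0; split=> [|x /double_primal_feasibleP ->].
    exact/double_primal_feasibleP.
  by right; rewrite subrr.
- exists u; split=> [|y]; first exact: double_dual_feasible1.
  by move/double_dual_feasible_ge1; rewrite !double_dual_valueE mxE.
move=> x y [/double_primal_feasibleP -> _] [/double_dual_feasible_ge1 y1 _].
rewrite double_dual_valueE /primal_value mulmx0 mxE => y0.
(* Equal values would give [y 0 0 = 0], turning the dual bound into [1 <= 0]. *)
move: y1; rewrite -y0 /ole sub0r; case=> [/(positives_asym positives1) //|/eqP].
by rewrite oppr_eq0 => /eqP /(positives_neq0 positives1).
Qed.

End OrderedRing.

Theorem theorem3p8 (R : pzRingType) (P : R -> Prop)
    (hP : positives P)
    (hR : ~ division_ring R)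
    (hp : exists p : R, smallest_positive P p) :
  exists (m n : nat) (A : 'M[R]_(m, n)) (b : 'cV[R]_m) (c : 'cV[R]_n),
    [/\ (0 < m)%N, (0 < n)%N,
        exists x, primal_optimal P A b c x,
        exists y, dual_optimal P A b c y &
        forall (x : 'cV[R]_n) (y : 'cV[R]_m),
          primal_optimal P A b c x -> dual_optimal P A b c y ->
          primal_value c x <> dual_value b y].
Proof.
have [p minp] := hp; have p1 := smallest_positive_eq1 hP minp; rewrite p1 in minp.
have [? ? ?] := double_duality_gap hP minp.
by exists 1%N, 1%N, (const_mx 2%:R), (const_mx 1), (const_mx 1); split.
Qed.
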